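(* Let $a<b$ be real numbers and let $\ell,m,n,r\in\overline{\mathbb N}_0$ be such that $1\le\ell,r\le n\le m$. Let $h\in\mathscr{F}_{\ell,r}^{m}[a,b]$, and set $\mathcal{B}(f):=hf$ (pointwise product) for $f\in C^{n}[a,b]$. Then (i) $\mathcal{B}$ is a linear operator from $C^{n}[a,b]$ into itself; (ii) $\mathcal{B}$ maps $\mathscr{F}_{\ell,r}^{n}[a,b]$ into itself; (iii) if $h(a)=0$ and $h(b)=1$, then $\mathcal{B}$ is a leftward blend-to-zero operator of orders $\ell$ and $r$; (iv) if $h(a)=1$ and $h(b)=0$, then $\mathcal{B}$ is a rightward blend-to-zero operator of orders $\ell$ and $r$.
   Context: $\overline{\mathbb N}_0=\{0,1,2,\dots\}\cup\{\infty\}$. When an order equals $\infty$, the corresponding conditions are understood to hold for every finite derivative order. $C^n[a,b]$ denotes the real-valued $n$-times continuously differentiable functions on $[a,b]$ (one-sided derivatives at endpoints). For $1\le\ell,r\le n$, $\mathscr{F}_{\ell,r}^{n}[a,b]$ is the set of functions $h\in C^n[a,b]$ with flat ends of orders $\ell$ and $r$, i.e. with $h^{(j)}(a)=0$ for $j=1,\dots,\ell$ and $h^{(k)}(b)=0$ for $k=1,\dots,r$. An operator $\mathcal{B}:C^{n}[a,b]\to C^{n}[a,b]$ is a rightward blend-to-zero operator of orders $\ell$ and $r$ (with $\ell,r\le n$) if for all $f\in C^{n}[a,b]$ the function $f_0=\mathcal{B}(f)$ satisfies $f_0^{(j)}(a)=f^{(j)}(a)$ for $j=0,\dots,\ell$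 and $f_0^{(k)}(b)=0$ for $k=0,\dots,r$. It is a leftward blend-to-zero operator of orders $\ell$ and $r$ if for all $g\in C^{n}[a,b]$ the function $g_0=\mathcal{B}(g)$ satisfies $g_0^{(j)}(a)=0$ for $j=0,\dots,\ell$ and $g_0^{(k)}(b)=g^{(k)}(b)$ for $k=0,\dots,r$. *)

(* Defs.v *)
From HB Require Import structures.
From mathcomp Require Import all_boot all_order all_algebra.
From mathcomp Require Import all_classical all_reals all_analysis.
Set Implicit Arguments.
Unset Strict Implicit.
Unset Printing Implicit Defensive.
Import Order.TTheory GRing.Theory Num.Theory.
Import numFieldNormedType.Exports.
Local Open Scope classical_set_scope.
Local Open Scope ring_scope.

(* The extended natural numbers {0, 1, 2, ...} U {oo}. *)
Inductive natbar := Fin of nat | Infty.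

Coercion Fin : nat >-> natbar.

Definition le_natbar (m n : natbar) : bool :=
  match m, n with
  | _, Infty => true
  | Infty, Fin _ => false
  | Fin m, Fin n => (m <= n)%N
  end.

Notation "m <=oo n" := (le_natbar m n) (at level 70, no associativity).
Notation "m <=oo n <=oo p" := (le_natbar m n && le_natbar n p)
  (at level 70, n at next level).

Section SmoothOnInterval.
Variables (R : realType) (a b : R).

(* The interval as a type; the library gives it the subspace topology, so a
   function seg -> R is a function defined on [a, b] and nowhere else. *)
Definition seg : topologicalType := set_type `[a, b].

Definition dquot (f : seg -> R) (x : seg) : seg -> R :=
  fun y => (f y - f x) / (\val y - \val x).

(* x^' is the punctured neighbourhood filter of x inside [a, b], so derivatives
   at a and b are the one-sided ones. *)
Definition seg_derivable (f : seg -> R) (x : seg) : Prop :=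
  cvg (dquot f x @ x^').

Definition seg_deriv (f : seg -> R) : seg -> R :=
  fun x => lim (dquot f x @ x^').

Definition seg_derivn (k : nat) (f : seg -> R) : seg -> R :=
  iter k seg_deriv f.

(* For n = oo both clauses range over all finite k. The values of the total
   operator seg_derivn are meaningful only where the first clause holds. *)
Definition Cn (n : natbar) : set (seg -> R) :=
  [set f | (forall (k : nat) (x : seg), k.+1 <=oo n ->
              seg_derivable (seg_derivn k f) x) /\
           (forall k : nat, k <=oo n -> continuous (seg_derivn k f))].

Lemma left_end_subproof (ab : a < b) : a \in `[a, b]%classic.
Proof. by rewrite mem_setE bound_itvE ltW. Qed.

Lemma right_end_subproof (ab : a < b) : b \in `[a, b]%classic.
Proof. by rewrite mem_setE bound_itvE ltW. Qed.

Definition left_end (ab : a < b) : seg := SigSub (left_end_subproof ab).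
Definition right_end (ab : a < b) : seg := SigSub (right_end_subproof ab).

Definition flat_ends (ab : a < b) (l r n : natbar) : set (seg -> R) :=
  [set h | [/\ Cn n h,
    forall j : nat, 1%N <=oo j <=oo l -> seg_derivn j h (left_end ab) = 0 &
    forall k : nat, 1%N <=oo k <=oo r -> seg_derivn k h (right_end ab) = 0]].

(* An operator C^n[a, b] -> C^n[a, b] is a map B on functions with
   set_fun (Cn n) (Cn n) B; only its values on C^n[a, b] matter. *)

Definition linear_operator_on (S : set (seg -> R))
    (B : (seg -> R) -> (seg -> R)) : Prop :=
  set_fun S S B /\
  forall (c : R) (f g : seg -> R), S f -> S g ->
    B (c *: f + g) = c *: B f + B g.

Definition rightward_blend_to_zero (ab : a < b) (n l r : natbar)
    (B : (seg -> R) -> (seg -> R)) : Prop :=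
  set_fun (Cn n) (Cn n) B /\
  forall f, Cn n f ->
    (forall j : nat, j <=oo l ->
       seg_derivn j (B f) (left_end ab) = seg_derivn j f (left_end ab)) /\
    (forall k : nat, k <=oo r -> seg_derivn k (B f) (right_end ab) = 0).

Definition leftward_blend_to_zero (ab : a < b) (n l r : natbar)
    (B : (seg -> R) -> (seg -> R)) : Prop :=
  set_fun (Cn n) (Cn n) B /\
  forall g, Cn n g ->
    (forall j : nat, j <=oo l -> seg_derivn j (B g) (left_end ab) = 0) /\
    (forall k : nat, k <=oo r ->
       seg_derivn k (B g) (right_end ab) = seg_derivn k g (right_end ab)).

End SmoothOnInterval.

(* Main.v *)
Require Import Defs.
From HB Require Import structures.
From mathcomp Require Import all_boot all_order all_algebra.
From mathcomp Require Import all_classical all_reals all_analysis.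
Set Implicit Arguments.
Unset Strict Implicit.
Unset Printing Implicit Defensive.
Import Order.TTheory GRing.Theory Num.Theory.
Import numFieldNormedType.Exports.
Local Open Scope classical_set_scope.
Local Open Scope ring_scope.

(** The whole statement rests on the Leibniz formula
    (h f)^(k) = sum_i 'C(k, i) h^(i) f^(k - i), here [seg_derivnM].
    It shows at once that C^n[a, b] is closed under products ([CnM]).  At an
    end point x where h is flat, i.e. h^(i)(x) = 0 for 1 <= i <= l, every term
    with i >= 1 disappears and (h f)^(k)(x) = h(x) f^(k)(x) for all k <= l
    ([seg_derivn_flatM]).  So h f inherits the flatness of f, and it carries
    the jet of f at an end where h = 1 and the zero jet at an end where h = 0;
    these are the claims.

    The Leibniz formula comes from the product rule by induction and Pascal's
    rule.  Derivatives are limits along the punctured neighbourhoods of [a, b],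
    and such limits are unique because [a, b] has no isolated point when a < b
    ([seg_dnbhs_proper]). *)

Lemma le_natbar_leq (i k : nat) (n : natbar) :
  (i <= k)%N -> k <=oo n -> i <=oo n.
Proof. by case: n => //= n; exact: leq_trans. Qed.

Lemma le_natbar_trans (k : nat) (m n : natbar) :
  k <=oo m -> m <=oo n -> k <=oo n.
Proof. by case: m n => [m|] [n|] //=; exact: leq_trans. Qed.

Section SegmentDerivative.
Variables (R : realType) (a b : R) (ab : a < b).
Implicit Types (f g : seg a b -> R) (x : seg a b).

Lemma seg_val_continuous : continuous (val : seg a b -> R).
Proof. exact: initial_continuous. Qed.

(** A point x < b is approached inside [a, b] from the right, and x = b from
    the left. *)
Lemma seg_dnbhs_proper x : ProperFilter x^'.
Proof.
apply: Build_ProperFilter_ex => U.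
rewrite /dnbhs /within /= nbhsE => -[B [[V oV VB] Bx BU]].
have Vx : nbhs (val x) V.
  by apply: open_nbhs_nbhs; split=> //; move: Bx; rewrite -VB.
have [ax xb] : a <= val x /\ val x <= b.
  by have /= := set_mem (valP x); rewrite in_itv /= => /andP.
suff [y [/andP[ay yb] yx Vy]] :
    exists y, [/\ a <= y <= b, y != val x & V y].
  have ys : y \in `[a, b]%classic by rewrite mem_setE in_itv /= ay yb.
  exists (SigSub ys : seg a b); apply: BU; first by rewrite -VB.
  by apply: contra_neq yx => <-.
have [xb'|bx] := ltP (val x) b.
  near (val x)^'+ => y; exists y; split; last 1 first.
  - by near: y; exact: cvg_within Vx.
  - apply/andP; split; last by near: y; apply: nbhs_right_le.
    by apply: le_trans ax _; near: y; apply: nbhs_right_ge.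
  - by near: y; apply: nbhs_right_neq.
have ax' : a < val x by exact: lt_le_trans bx.
near (val x)^'- => y; exists y; split; last 1 first.
- by near: y; exact: cvg_within Vx.
- apply/andP; split; first by near: y; apply: nbhs_left_ge.
  by apply: le_trans xb; near: y; apply: nbhs_left_le.
- by near: y; apply: nbhs_left_neq.
Unshelve. all: by end_near. Qed.

Local Existing Instance seg_dnbhs_proper.

(** [d] is the derivative of [f] at [x]; the relational form packages
    derivability with the value, so that calculus rules need no side
    conditions. *)
Definition is_seg_deriv f x (d : R) : Prop := dquot f x @ x^' --> d.

Lemma is_seg_derivE f x d : is_seg_deriv f x d -> seg_deriv f x = d.
Proof. exact: cvg_lim. Qed.

Lemma is_seg_deriv_cst (c : R) x : is_seg_deriv (fun=> c) x 0.
Proof.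
rewrite /is_seg_deriv (_ : dquot _ x = fun=> 0); first exact: cvg_cst.
by apply/funext => y; rewrite /dquot subrr mul0r.
Qed.

Lemma is_seg_derivD f g x d e : is_seg_deriv f x d -> is_seg_deriv g x e ->
  is_seg_deriv (fun y => f y + g y) x (d + e).
Proof.
move=> df dg; rewrite /is_seg_deriv.
rewrite (_ : dquot _ x = dquot f x \+ dquot g x); first exact: cvgD.
by apply/funext => y; rewrite /dquot /= -mulrDl addrACA opprD.
Qed.

Lemma is_seg_derivMn f x d n : is_seg_deriv f x d ->
  is_seg_deriv (fun y => f y *+ n) x (d *+ n).
Proof.
move=> df; rewrite /is_seg_deriv.
rewrite (_ : dquot _ x = (@GRing.natmul _)^~ n \o dquot f x).
  exact: cvgMn.
by apply/funext => y; rewrite /dquot /= -mulrnBl mulrnAl.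
Qed.

(** Off x, f y is the difference quotient times (y - x), plus f x. *)
Lemma is_seg_deriv_cvg f x d : is_seg_deriv f x d -> f @ x^' --> f x.
Proof.
move=> df.
have vx : (fun y => val y - val x) @ x^' --> (0 : R).
  rewrite -(subrr (val x)); apply: cvgB; last exact: cvg_cst.
  by move=> U /(@seg_val_continuous x); exact: nbhs_dnbhs.
have fx : (fun y => dquot f x y * (val y - val x) + f x) @ x^' --> f x.
  rewrite -[X in _ --> X]add0r -(mulr0 d).
  by apply: cvgD; [exact: cvgM|exact: cvg_cst].
apply: cvg_trans fx; apply: near_eq_cvg; near=> y.
rewrite /dquot /= -mulrA mulVf ?mulr1 ?subrK //.
rewrite subr_eq0 (inj_eq val_inj); near: y; exact: nbhs_dnbhs_neq.
Unshelve. all: by end_near. Qed.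

Lemma is_seg_derivM f g x d e : is_seg_deriv f x d -> is_seg_deriv g x e ->
  is_seg_deriv (fun y => f y * g y) x (d * g x + f x * e).
Proof.
move=> df dg; rewrite /is_seg_deriv.
rewrite (_ : dquot _ x = fun y => dquot f x y * g y + f x * dquot g x y).
  apply: cvgD; first by apply: cvgM => //; exact: is_seg_deriv_cvg dg.
  by apply: cvgM => //; exact: cvg_cst.
apply/funext => y; rewrite /dquot mulrAC mulrA -mulrDl; congr (_ / _).
by rewrite mulrBl mulrBr addrA subrK.
Qed.

Lemma is_seg_deriv_sum (I : Type) (s : seq I) (F : I -> seg a b -> R)
    (D : I -> R) x :
  (forall i, is_seg_deriv (F i) x (D i)) ->
  is_seg_deriv (fun y => \sum_(i <- s) F i y) x (\sum_(i <- s) D i).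
Proof.
move=> FD; elim: s => [|i s IHs].
  rewrite big_nil (_ : (fun _ => _) = fun=> 0); first exact: is_seg_deriv_cst.
  by apply/funext => y; rewrite big_nil.
rewrite big_cons (_ : (fun _ => _) = fun y => F i y + \sum_(i <- s) F i y).
  exact: is_seg_derivD.
by apply/funext => y; rewrite big_cons.
Qed.

Definition leibniz_sum (k : nat) f g : seg a b -> R := fun x =>
  \sum_(i < k.+1) (seg_derivn i f x * seg_derivn (k - i) g x) *+ 'C(k, i).

(** Differentiating each product splits the sum in two; shifting the index of
    the first half and adding is Pascal's rule. *)
Lemma is_seg_deriv_leibniz_sum k f g x :
  (forall i, (i <= k)%N -> seg_derivable (seg_derivn i f) x) ->
  (forall i, (i <= k)%N -> seg_derivable (seg_derivn i g) x) ->
  is_seg_deriv (leibniz_sum k f g) x (leibniz_sum k.+1 f g x).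
Proof.
move=> df dg.
pose F i := seg_derivn i f x; pose G i := seg_derivn i g x.
rewrite [leibniz_sum k.+1 f g x](_ : _ =
    \sum_(i < k.+1) (F i.+1 * G (k - i)%N + F i * G (k - i).+1) *+ 'C(k, i));
    last first.
  rewrite -[LHS]/(\sum_(i < k.+2) (F i * G (k.+1 - i)%N) *+ 'C(k.+1, i)).
  under [RHS]eq_bigr do rewrite mulrnDl.
  rewrite big_split /= [LHS]big_ord_recl subn0 bin0.
  under [X in _ + X = _]eq_bigr do rewrite lift0 subSS binS mulrnDr.
  rewrite big_split /= addrA addrC; congr (_ + _).
  (* Both sides equal this sum, whose last term vanishes as 'C(k, k.+1) = 0. *)
  transitivity (\sum_(i < k.+2) (F i * G (k.+1 - i)%N) *+ 'C(k, i)).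
    by rewrite [RHS]big_ord_recl subn0 bin0.
  rewrite [LHS]big_ord_recr /= bin_small // mulr0n addr0.
  by apply: eq_bigr => i _; rewrite /= subSn // -ltnS.
apply: is_seg_deriv_sum => i; apply: is_seg_derivMn; apply: is_seg_derivM.
  by apply: df; rewrite -ltnS.
by apply: dg; exact: leq_subr.
Qed.

Lemma seg_derivnM k f g :
  (forall i x, (i < k)%N -> seg_derivable (seg_derivn i f) x) ->
  (forall i x, (i < k)%N -> seg_derivable (seg_derivn i g) x) ->
  seg_derivn k (f \* g) = leibniz_sum k f g.
Proof.
elim: k => [|k IHk] df dg.
  by apply/funext => x; rewrite /leibniz_sum big_ord1 bin0.
rewrite [LHS]/= -/(seg_derivn k _) IHk; last 2 first.
- by move=> i x ik; apply: df; exact: ltnW.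
- by move=> i x ik; apply: dg; exact: ltnW.
apply/funext => x; apply: is_seg_derivE.
by apply: is_seg_deriv_leibniz_sum => i ik; [exact: df|exact: dg].
Qed.

Lemma Cn_derivable n f (k i : nat) x :
  Cn n f -> k <=oo n -> (i < k)%N -> seg_derivable (seg_derivn i f) x.
Proof. by move=> [df _] kn ik; apply: df; exact: le_natbar_leq kn. Qed.

Lemma Cn_seg_derivnM n f g (k : nat) : Cn n f -> Cn n g -> k <=oo n ->
  seg_derivn k (f \* g) = leibniz_sum k f g.
Proof.
by move=> fn gn kn; apply: seg_derivnM => i x; [exact: Cn_derivable fn kn|
  exact: Cn_derivable gn kn].
Qed.

Lemma CnM n f g : Cn n f -> Cn n g -> Cn n (f \* g).
Proof.
move=> fn gn; split=> [k x kn|k kn].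
  rewrite (Cn_seg_derivnM fn gn (le_natbar_leq (leqnSn k) kn)).
  apply: (cvgP (leibniz_sum k.+1 f g x)).
  by apply: is_seg_deriv_leibniz_sum => i ik;
    [exact: Cn_derivable fn kn _|exact: Cn_derivable gn kn _].
rewrite (Cn_seg_derivnM fn gn kn).
apply: continuous_big => [|i _ x]; first exact: add_continuous.
have cf : {for x, continuous (seg_derivn i f)}.
  by apply: fn.2; apply: le_natbar_leq kn; rewrite -ltnS.
have cg : {for x, continuous (seg_derivn (k - i) g)}.
  by apply: gn.2; apply: le_natbar_leq kn; exact: leq_subr.
exact: cvgMn (cvgM cf cg).
Qed.

Lemma Cn_le n m f : n <=oo m -> Cn m f -> Cn n f.
Proof.
move=> nm [df cf].
by split=> [k x|k] kn; [apply: df|apply: cf]; exact: le_natbar_trans nm.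
Qed.

(** At a point where [h] is flat, multiplication by [h] acts on jets as
    multiplication by the number [h x]: only the term of the Leibniz formula
    without derivatives of [h] survives. *)
Lemma seg_derivn_flatM n l h f x (k : nat) : Cn n h -> Cn n f ->
  (forall j : nat, 1%N <=oo j <=oo l -> seg_derivn j h x = 0) ->
  k <=oo n -> k <=oo l ->
  seg_derivn k (h \* f) x = h x * seg_derivn k f x.
Proof.
move=> hn fn h0 kn kl; rewrite (Cn_seg_derivnM hn fn kn) /leibniz_sum.
rewrite big_ord_recl subn0 bin0 big1 ?addr0 // => i _.
rewrite lift0 h0 ?mul0r ?mul0rn //.
exact: le_natbar_leq kl.
Qed.

End SegmentDerivative.

Theorem theorem9 (R : realType) (a b : R) (ab : a < b)
    (l m n r : natbar)
    (l_ge1 : 1%N <=oo l) (r_ge1 : 1%N <=oo r)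
    (l_le_n : l <=oo n) (r_le_n : r <=oo n) (n_le_m : n <=oo m)
    (h : seg a b -> R) (hF : flat_ends ab l r m h) :
  let B : (seg a b -> R) -> (seg a b -> R) := fun f => h \* f in
  [/\ linear_operator_on (@Cn R a b n) B,
      set_fun (flat_ends ab l r n) (flat_ends ab l r n) B,
      h (left_end ab) = 0 -> h (right_end ab) = 1 ->
        leftward_blend_to_zero ab n l r B &
      h (left_end ab) = 1 -> h (right_end ab) = 0 ->
        rightward_blend_to_zero ab n l r B].
Proof.
move=> B; case: hF => hm ha hb.
have hn := Cn_le n_le_m hm.
have Bn : set_fun (Cn n) (Cn n) B by move=> f; exact: CnM.
have Ba f (k : nat) : Cn n f -> k <=oo l ->
    seg_derivn k (B f) (left_end ab) =
      h (left_end ab) * seg_derivn k f (left_end ab).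
  move=> fn kl; apply: (seg_derivn_flatM ab hn fn ha) => //.
  exact: le_natbar_trans l_le_n.
have Bb f (k : nat) : Cn n f -> k <=oo r ->
    seg_derivn k (B f) (right_end ab) =
      h (right_end ab) * seg_derivn k f (right_end ab).
  move=> fn kr; apply: (seg_derivn_flatM ab hn fn hb) => //.
  exact: le_natbar_trans r_le_n.
split.
- split=> // c f g _ _; apply/funext => x.
  by rewrite /B !fctE /= mulrDr scalerAr.
- move=> f [fn fa fb]; split; first exact: Bn.
    by move=> j jl; rewrite Ba ?fa ?mulr0 //; case/andP: jl.
  by move=> k kr; rewrite Bb ?fb ?mulr0 //; case/andP: kr.
- move=> h0 h1; split=> // g gn; split=> [j jl|k kr].
    by rewrite Ba // h0 mul0r.
  by rewrite Bb // h1 mul1r.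
- move=> h1 h0; split=> // f fn; split=> [j jl|k kr].
    by rewrite Ba // h1 mul1r.
  by rewrite Bb // h0 mul0r.
Qed.
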